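(* Let $\tau$ be the transformation $\tau(x_i)=\zeta_8^{-i}x_i$ of $\mathbb{CP}^7$, where $\zeta_8$ is a primitive $8$th root of unity. Let $G_1$ be the group generated by $\tau$ and the permutation $\sigma_1=(07214365)$ of the coordinates $x_i$. Then $G_1$ is a nonabelian group isomorphic to a semidirect product of two copies of $\mathbb{Z}/8\mathbb{Z}$. Let $G_2$ be the group generated by $\tau$ and the permutations $\sigma_2=(0246)(1357)$ and $\sigma_3=(0145)(3276)$ of the coordinates $x_i$. Then $G_2$ is a nonabelian group isomorphic to a semidirect product of the normal subgroup $\mathbb{Z}/8\mathbb{Z}$ generated by $\tau$ and the quaternion group $H$ (of order $8$) generated by $\sigma_2$ and $\sigma_3$. Moreover, for $(y_1:y_2:y_3)\in\mathbb{CP}^2$ in general position, both $G_1$ and $G_2$ act freely on the variety $V_{8,y}\subset\mathbb{CP}^7$ defined in the context.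
   Context: Work over $\mathbb{C}$. Let $\mathbb{CP}^7$ have homogeneous coordinates $(x_0:\ldots:x_7)$. The groups $G_1,G_2$ are groups of projective transformations of $\mathbb{CP}^7$, i.e. subgroups of $\mathrm{PGL}_8(\mathbb{C})$. Permutations of coordinates are written in cycle notation on the index set $\{0,1,\ldots,7\}$; e.g. $\sigma_1=(07214365)$ sends $x_0\mapsto x_7\mapsto x_2\mapsto x_1\mapsto x_4\mapsto x_3\mapsto x_6\mapsto x_5\mapsto x_0$. For $(y_1:y_2:y_3)\in\mathbb{CP}^2$ in general position (i.e. in a suitable nonempty Zariski open subset), $V_{8,y}\subset\mathbb{CP}^7$ is the intersection of the four quadrics $$ \begin{array}{l} y_1y_3(x_0^2+x_4^2) - y_2^2(x_1x_7+x_3x_5)+(y_1^2+y_3^2)x_2x_6=0\\ y_1y_3(x_1^2+x_5^2) - y_2^2(x_2x_0+x_4x_6)+(y_1^2+y_3^2)x_3x_7=0\\ y_1y_3(x_2^2+x_6^2) - y_2^2(x_3x_1+x_5x_7)+(y_1^2+y_3^2)x_4x_0=0\\ y_1y_3(x_3^2+x_7^2) - y_2^2(x_4x_2+x_6x_0)+(y_1^2+y_3^2)x_5x_1=0. \end{array} $$ *)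

(* Defs.v *)
From HB Require Import structures.
From mathcomp Require Import all_boot all_order all_algebra all_fingroup.
From mathcomp Require Import gproduct extremal.
From mathcomp Require Import mpoly.
From mathcomp Require Import ssrbool generic_quotient boolp classical_sets reals complex ring.

Set Implicit Arguments.
Unset Strict Implicit.
Unset Printing Implicit Defensive.

Import GRing.Theory.

Local Open Scope quotient_scope.
Local Open Scope classical_set_scope.
Local Open Scope ring_scope.

Section Groups.
Variable gT : groupType.
Implicit Types G H N S : set gT.
Local Open Scope group_scope.

Definition is_subgroup H :=
  [/\ H 1, forall x y, H x -> H y -> H (x * y) & forall x, H x -> H x^-1].

Definition gen S : set gT := smallest is_subgroup S.

Definition nonabelian G := exists x y, [/\ G x, G y & x * y <> y * x].

Definition is_normal N G :=
  [/\ is_subgroup N, N `<=` G & forall x g, N x -> G g -> N (g^-1 * x * g)].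

(* Internal semidirect product, N normal: the analogue of N ><| H = G. *)
Definition is_sdprod G N H :=
  [/\ is_normal N G, is_subgroup H, [set x * y | x in N & y in H] = G
    & N `&` H = [set 1]].

Definition iso_fin (hT : finGroupType) G :=
  exists f : hT -> gT, [/\ {morph f : x y / x * y}, injective f & range f = G].

End Groups.

Section ProjectiveSpace.
Variables (F : fieldType) (n : nat).

Definition nzvec := {x : 'cV[F]_n.+1 | x != 0}.

Definition nzvec_eqv (x y : nzvec) : bool :=
  `[< exists2 c : F, c != 0 & val y = c *: val x >].

Lemma nzvec_eqv_refl : reflexive nzvec_eqv.
Proof. by move=> x; apply/asboolP; exists 1; rewrite ?oner_neq0 ?scale1r. Qed.

Lemma nzvec_eqv_sym : symmetric nzvec_eqv.
Proof.
suff H x y : nzvec_eqv x y -> nzvec_eqv y x by move=> x y; apply/idP/idP; exact: H.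
move=> /asboolP[c c0 e]; apply/asboolP.
by exists c^-1; rewrite ?invr_eq0 // e scalerA mulVf ?scale1r.
Qed.

Lemma nzvec_eqv_trans : transitive nzvec_eqv.
Proof.
move=> y x z /asboolP[c c0 e] /asboolP[d d0 e']; apply/asboolP.
by exists (d * c); rewrite ?mulf_neq0 // e' e scalerA.
Qed.

Canonical nzvec_equiv :=
  EquivRel nzvec_eqv nzvec_eqv_refl nzvec_eqv_sym nzvec_eqv_trans.

(* P^n(F): n is the projective dimension, so there are n.+1 coordinates. *)
Definition proj := {eq_quot nzvec_equiv}.
HB.instance Definition _ := Choice.on proj.
HB.instance Definition _ := EqQuotient.on proj.

Definition proj_pt (x : 'cV[F]_n.+1) (x0 : x != 0) : proj := \pi_proj (Sub x x0).

Lemma proj_ptP (x y : 'cV[F]_n.+1) (x0 : x != 0) (y0 : y != 0) :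
  proj_pt x0 = proj_pt y0 <-> exists2 c : F, c != 0 & y = c *: x.
Proof.
split; first by move/eqquotP/asboolP.
by move=> h; apply/eqquotP/asboolP.
Qed.

Lemma proj_ptW (P : proj -> Prop) :
  (forall x (x0 : x != 0), P (proj_pt x0)) -> forall p, P p.
Proof. by move=> h p; elim/quotW: p => -[x x0]; apply: h. Qed.

(* S is meant to consist of homogeneous polynomials, whose vanishing does not
   depend on the choice of homogeneous coordinates. *)
Definition zero_locus (S : set {mpoly F[n.+1]}) : set proj :=
  [set p | forall f x (x0 : x != 0), S f -> proj_pt x0 = p ->
    f.@[fun i => x i 0] = 0].

Definition zariski_closed (Z : set proj) :=
  exists S : set {mpoly F[n.+1]},
    (forall f, S f -> exists d, f \is d.-homog) /\ Z = zero_locus S.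

Definition zariski_open (U : set proj) := zariski_closed (~` U).

End ProjectiveSpace.

Section ProjectiveLinearGroup.
Variables (F : fieldType) (n : nat).

Definition GL := {A : 'M[F]_n.+1 | A \in unitmx}.

Definition GL_eqv (A B : GL) : bool :=
  `[< exists2 c : F, c != 0 & val B = c *: val A >].

Lemma GL_eqv_refl : reflexive GL_eqv.
Proof. by move=> x; apply/asboolP; exists 1; rewrite ?oner_neq0 ?scale1r. Qed.

Lemma GL_eqv_sym : symmetric GL_eqv.
Proof.
suff H x y : GL_eqv x y -> GL_eqv y x by move=> x y; apply/idP/idP; exact: H.
move=> /asboolP[c c0 e]; apply/asboolP.
by exists c^-1; rewrite ?invr_eq0 // e scalerA mulVf ?scale1r.
Qed.

Lemma GL_eqv_trans : transitive GL_eqv.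
Proof.
move=> y x z /asboolP[c c0 e] /asboolP[d d0 e']; apply/asboolP.
by exists (d * c); rewrite ?mulf_neq0 // e' e scalerA.
Qed.

Canonical GL_equiv := EquivRel GL_eqv GL_eqv_refl GL_eqv_sym GL_eqv_trans.

(* PGL_(n+1)(F), the projective linear group of P^n(F). *)
Definition PGL := {eq_quot GL_equiv}.
HB.instance Definition _ := Choice.on PGL.
HB.instance Definition _ := EqQuotient.on PGL.

Definition PGL_mx (A : 'M[F]_n.+1) (uA : A \in unitmx) : PGL := \pi_PGL (Sub A uA).

Lemma PGL_mxP (A B : 'M[F]_n.+1) (uA : A \in unitmx) (uB : B \in unitmx) :
  PGL_mx uA = PGL_mx uB <-> exists2 c : F, c != 0 & B = c *: A.
Proof.
split; first by move/eqquotP/asboolP.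
by move=> h; apply/eqquotP/asboolP.
Qed.

Lemma PGL_mxW (P : PGL -> Prop) :
  (forall A (uA : A \in unitmx), P (PGL_mx uA)) -> forall g, P g.
Proof. by move=> h p; elim/quotW: p => -[A uA]; apply: h. Qed.

Lemma GL_mul_unit (A B : GL) : val A *m val B \in unitmx.
Proof. by rewrite unitmx_mul (valP A) (valP B). Qed.

Lemma GL_inv_unit (A : GL) : invmx (val A) \in unitmx.
Proof. by rewrite unitmx_inv (valP A). Qed.

Definition PGL_one : PGL := PGL_mx (unitmx1 F n.+1).
Definition PGL_mul (g h : PGL) : PGL := PGL_mx (GL_mul_unit (repr g) (repr h)).
Definition PGL_inv (g : PGL) : PGL := PGL_mx (GL_inv_unit (repr g)).

Lemma repr_PGL_mx (A : 'M[F]_n.+1) (uA : A \in unitmx) :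
  exists2 c : F, c != 0 & val (repr (PGL_mx uA)) = c *: A.
Proof.
by apply/(PGL_mxP uA (valP (repr (PGL_mx uA)))); rewrite -[LHS]reprK /PGL_mx; congr (\pi _); apply: val_inj.
Qed.

Lemma PGL_mulE (A B : 'M[F]_n.+1) (uA : A \in unitmx) (uB : B \in unitmx)
    (uAB : A *m B \in unitmx) :
  PGL_mul (PGL_mx uA) (PGL_mx uB) = PGL_mx uAB.
Proof.
have [c c0 eA] := repr_PGL_mx uA; have [d d0 eB] := repr_PGL_mx uB.
apply/esym/PGL_mxP; exists (c * d); first by rewrite mulf_neq0.
by rewrite eA eB -scalemxAl -scalemxAr scalerA.
Qed.

Lemma PGL_invE (A : 'M[F]_n.+1) (uA : A \in unitmx) (uV : invmx A \in unitmx) :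
  PGL_inv (PGL_mx uA) = PGL_mx uV.
Proof.
have [c c0 eA] := repr_PGL_mx uA.
apply/esym/PGL_mxP; exists c^-1; first by rewrite invr_eq0.
by rewrite eA invmxZ // -eA; exact: valP.
Qed.

Lemma PGL_mulA : associative PGL_mul.
Proof.
elim/PGL_mxW=> A uA; elim/PGL_mxW=> B uB; elim/PGL_mxW=> C uC.
have uAB : A *m B \in unitmx by rewrite unitmx_mul uA.
have uBC : B *m C \in unitmx by rewrite unitmx_mul uB.
have uABC : A *m B *m C \in unitmx by rewrite unitmx_mul uAB.
have uABC' : A *m (B *m C) \in unitmx by rewrite mulmxA.
rewrite !PGL_mulE; apply/PGL_mxP.
by exists 1; rewrite ?oner_neq0 // scale1r mulmxA.
Qed.

Lemma PGL_mul1 : left_id PGL_one PGL_mul.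
Proof.
elim/PGL_mxW=> A uA; have u : 1%:M *m A \in unitmx by rewrite mul1mx.
by rewrite PGL_mulE; apply/PGL_mxP; exists 1; rewrite ?oner_neq0 // scale1r mul1mx.
Qed.

Lemma PGL_mulr1 : right_id PGL_one PGL_mul.
Proof.
elim/PGL_mxW=> A uA; have u : A *m 1%:M \in unitmx by rewrite mulmx1.
by rewrite PGL_mulE; apply/PGL_mxP; exists 1; rewrite ?oner_neq0 // scale1r mulmx1.
Qed.

Lemma PGL_mulV : left_inverse PGL_one PGL_inv PGL_mul.
Proof.
elim/PGL_mxW=> A uA; have uV : invmx A \in unitmx by rewrite unitmx_inv.
have u : invmx A *m A \in unitmx by rewrite unitmx_mul uV.
rewrite PGL_invE PGL_mulE; apply/PGL_mxP.
by exists 1; rewrite ?oner_neq0 // scale1r mulVmx.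
Qed.

Lemma PGL_mulrV : right_inverse PGL_one PGL_inv PGL_mul.
Proof.
elim/PGL_mxW=> A uA; have uV : invmx A \in unitmx by rewrite unitmx_inv.
have u : A *m invmx A \in unitmx by rewrite unitmx_mul uV andbT.
rewrite PGL_invE PGL_mulE; apply/PGL_mxP.
by exists 1; rewrite ?oner_neq0 // scale1r mulmxV.
Qed.

HB.instance Definition _ :=
  isGroup.Build PGL PGL_mulA PGL_mul1 PGL_mulr1 PGL_mulV PGL_mulrV.

Lemma GL_act_neq0 (A : GL) (x : nzvec F n) : val A *m val x != 0.
Proof.
apply/eqP=> e; have := valP x; rewrite /= -[val x](mulKmx (valP A)) e mulmx0.
by rewrite eqxx.
Qed.

Definition proj_act (g : PGL) (p : proj F n) : proj F n :=
  proj_pt (GL_act_neq0 (repr g) (repr p)).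

Lemma proj_actE (A : 'M[F]_n.+1) (uA : A \in unitmx) (x : 'cV[F]_n.+1)
    (x0 : x != 0) (Ax0 : A *m x != 0) :
  proj_act (PGL_mx uA) (proj_pt x0) = proj_pt Ax0.
Proof.
have [c c0 eA] := repr_PGL_mx uA.
have [d d0 ex] : exists2 d : F, d != 0 & val (repr (proj_pt x0)) = d *: x.
  apply/(proj_ptP x0 (valP (repr (proj_pt x0)))).
  by rewrite -[LHS]reprK /proj_pt; congr (\pi _); apply: val_inj.
apply/esym/proj_ptP; exists (c * d); first by rewrite mulf_neq0.
by rewrite eA ex -scalemxAl -scalemxAr scalerA.
Qed.

Definition acts_freely (G : set PGL) (V : set (proj F n)) :=
  (forall g p, G g -> V p -> V (proj_act g p)) /\
  (forall g p, G g -> V p -> proj_act g p = p -> g = 1%g).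

End ProjectiveLinearGroup.

(* next c maps each entry of c to its cyclic successor, fixing the rest. *)
Definition cycle_perm (T : finType) (c : seq T) (Uc : uniq c) : {perm T} :=
  perm (can_inj (prev_next Uc)).

Definition idx8 (s : seq nat) : seq 'I_8 := map inZp s.

Definition s1 : 'S_8 := @cycle_perm _ (idx8 [:: 0; 7; 2; 1; 4; 3; 6; 5]%N) isT.

Definition s2 : 'S_8 :=
  (@cycle_perm _ (idx8 [:: 0; 2; 4; 6]%N) isT
   * @cycle_perm _ (idx8 [:: 1; 3; 5; 7]%N) isT)%g.

Definition s3 : 'S_8 :=
  (@cycle_perm _ (idx8 [:: 0; 1; 4; 5]%N) isT
   * @cycle_perm _ (idx8 [:: 3; 2; 7; 6]%N) isT)%g.

Section Transformations.
Variable F : fieldType.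

(* (perm_mx s *m x) i 0 = x (s i) 0: x_(s i) is substituted for x_i. *)
Definition proj_perm (s : 'S_8) : PGL F 7 := PGL_mx (unitmx_perm F s).

Lemma tau_unitmx (z : F) : 8.-primitive_root z ->
  diag_mx (\row_(i < 8) z ^- i) \in unitmx.
Proof.
move=> hz; have z0 : z != 0.
  by apply/eqP=> z0; have := prim_expr_order hz; rewrite z0 expr0n => /esym/eqP; rewrite oner_eq0.
rewrite unitmxE unitfE det_diag; apply/prodf_neq0 => i _.
by rewrite mxE invr_eq0 expf_neq0.
Qed.

Definition tau (z : F) (hz : 8.-primitive_root z) : PGL F 7 :=
  PGL_mx (tau_unitmx hz).

Definition sigma1 := proj_perm s1.
Definition sigma2 := proj_perm s2.
Definition sigma3 := proj_perm s3.

Definition G1 (z : F) (hz : 8.-primitive_root z) : set (PGL F 7) :=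
  gen [set tau hz; sigma1].

Definition G2 (z : F) (hz : 8.-primitive_root z) : set (PGL F 7) :=
  gen [set g | [\/ g = tau hz, g = sigma2 | g = sigma3]].

Local Notation X i := ('X_(inZp i) : {mpoly F[8]}).

Definition quadrics (y : 'cV[F]_3) : seq {mpoly F[8]} :=
  let y1 := y 0 0 in let y2 := y 1 0 in let y3 := y 2%R 0 in
  [:: (y1 * y3) *: (X 0 ^+ 2 + X 4 ^+ 2) - (y2 ^+ 2) *: (X 1 * X 7 + X 3 * X 5)
        + (y1 ^+ 2 + y3 ^+ 2) *: (X 2 * X 6);
      (y1 * y3) *: (X 1 ^+ 2 + X 5 ^+ 2) - (y2 ^+ 2) *: (X 2 * X 0 + X 4 * X 6)
        + (y1 ^+ 2 + y3 ^+ 2) *: (X 3 * X 7);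
      (y1 * y3) *: (X 2 ^+ 2 + X 6 ^+ 2) - (y2 ^+ 2) *: (X 3 * X 1 + X 5 * X 7)
        + (y1 ^+ 2 + y3 ^+ 2) *: (X 4 * X 0);
      (y1 * y3) *: (X 3 ^+ 2 + X 7 ^+ 2) - (y2 ^+ 2) *: (X 4 * X 2 + X 6 * X 0)
        + (y1 ^+ 2 + y3 ^+ 2) *: (X 5 * X 1)].

Definition V8 (y : 'cV[F]_3) : set (proj F 7) :=
  zero_locus [set f | f \in quadrics y].

Local Notation x_ v i := (v (inZp i) 0).

Lemma V8P (y : 'cV[F]_3) (v : 'cV[F]_8) (v0 : v != 0) :
  let y1 := y 0 0 in let y2 := y 1 0 in let y3 := y 2%R 0 in
  V8 y (proj_pt v0) <->
  [/\ y1 * y3 * (x_ v 0 ^+ 2 + x_ v 4 ^+ 2) - y2 ^+ 2 * (x_ v 1 * x_ v 7 + x_ v 3 * x_ v 5)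
        + (y1 ^+ 2 + y3 ^+ 2) * (x_ v 2 * x_ v 6) = 0,
      y1 * y3 * (x_ v 1 ^+ 2 + x_ v 5 ^+ 2) - y2 ^+ 2 * (x_ v 2 * x_ v 0 + x_ v 4 * x_ v 6)
        + (y1 ^+ 2 + y3 ^+ 2) * (x_ v 3 * x_ v 7) = 0,
      y1 * y3 * (x_ v 2 ^+ 2 + x_ v 6 ^+ 2) - y2 ^+ 2 * (x_ v 3 * x_ v 1 + x_ v 5 * x_ v 7)
        + (y1 ^+ 2 + y3 ^+ 2) * (x_ v 4 * x_ v 0) = 0
    & y1 * y3 * (x_ v 3 ^+ 2 + x_ v 7 ^+ 2) - y2 ^+ 2 * (x_ v 4 * x_ v 2 + x_ v 6 * x_ v 0)
        + (y1 ^+ 2 + y3 ^+ 2) * (x_ v 5 * x_ v 1) = 0].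
Proof.
have mE := (mevalB, mevalD, mevalZ, mevalM, mevalXU); split=> /=.
  move=> h; split; have := h _ v v0 _ erefl.
  - by move=> /(_ (nth 0 (quadrics y) 0)); rewrite /= !inE eqxx => /(_ isT); rewrite !expr2 !mE.
  - by move=> /(_ (nth 0 (quadrics y) 1)); rewrite /= !inE eqxx !orbT => /(_ isT); rewrite !expr2 !mE.
  - by move=> /(_ (nth 0 (quadrics y) 2)); rewrite /= !inE eqxx !orbT => /(_ isT); rewrite !expr2 !mE.
  - by move=> /(_ (nth 0 (quadrics y) 3)); rewrite /= !inE eqxx !orbT => /(_ isT); rewrite !expr2 !mE.
move=> [e1 e2 e3 e4] f w w0 /= + /esym/proj_ptP [c c0 ->].
rewrite !inE => /or4P[] /eqP ->; rewrite !expr2 !mE !mxE.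
- by rewrite -[RHS](mulr0 (c ^+ 2)) -[in RHS]e1; ring.
- by rewrite -[RHS](mulr0 (c ^+ 2)) -[in RHS]e2; ring.
- by rewrite -[RHS](mulr0 (c ^+ 2)) -[in RHS]e3; ring.
- by rewrite -[RHS](mulr0 (c ^+ 2)) -[in RHS]e4; ring.
Qed.

End Transformations.

(* Main.v *)
Require Import Defs.
From HB Require Import structures.
From mathcomp Require Import all_boot all_order all_algebra all_fingroup.
From mathcomp Require Import gproduct extremal.
From mathcomp Require Import mpoly.
From mathcomp Require Import ssrbool generic_quotient boolp classical_sets reals complex.
From mathcomp Require Import ring cyclic.

Set Implicit Arguments.
Unset Strict Implicit.
Unset Printing Implicit Defensive.

Import GRing.Theory Num.Theory.

Local Open Scope classical_set_scope.
Local Open Scope ring_scope.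

(* Every element of G1 and G2 is tau^n * pi(s) for a permutation s of Z/8 of the
   form i |-> w^v * i + v, with w = 5 for G1 and w = 3 for G2.  Since both groups
   have exponent dividing 64, an element with a fixed point on V8 that is not the
   identity has a power of order two with a fixed point, and the only involutions
   are tau^4, kappa : x_i |-> x_(i+4) and tau^4 * kappa.  With a = y1 y3,
   b = y1^2 + y3^2 and c = y2^2, substituting the eigenspaces of these three
   matrices in the quadrics leaves only x = 0 as soon as the product
   [discriminant a b c] is nonzero; it is nonzero at y = (1 : 1 : 2). *)

(** * Generated subgroups and their images under morphisms from finite groups *)

Section GeneratedSubgroups.
Variable gT : groupType.
Implicit Types S K : set gT.
Local Open Scope group_scope.

Lemma sub_gen S : S `<=` gen S.
Proof. exact: sub_gen_smallest. Qed.

Lemma gen_sub S K : is_subgroup K -> S `<=` K -> gen S `<=` K.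
Proof. exact: smallest_sub. Qed.

Lemma gen_subgroup S : is_subgroup (gen S).
Proof.
split=> [K [[]] // | x y Gx Gy K KS | x Gx K KS].
  by case: (KS) => -[_ KM _] _; apply: KM; [apply: Gx | apply: Gy].
by case: (KS) => -[_ _ KV] _; apply: KV; apply: Gx.
Qed.

Lemma subgroupX K (x : gT) n : is_subgroup K -> K x -> K (x ^+ n).
Proof.
case=> K1 KM _ Kx; elim: n => [|n IHn]; first by rewrite expg0.
by rewrite expgS; apply: KM.
Qed.

Section Morphism.
Variables (hT : finGroupType) (f : hT -> gT).
Hypothesis fM : {morph f : x y / x * y}.

Lemma morph_one : f 1 = 1.
Proof. by apply: (@mulgI _ (f 1)); rewrite -fM !mulg1. Qed.

Lemma morph_inv x : f x^-1 = (f x)^-1.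
Proof. by apply: (@mulgI _ (f x)); rewrite -fM !mulgV morph_one. Qed.

Lemma morph_exp x n : f (x ^+ n) = f x ^+ n.
Proof.
by elim: n => [|n IHn]; [rewrite expg0 expg0 morph_one | rewrite !expgS fM IHn].
Qed.

Lemma image_subgroup (H : {group hT}) : is_subgroup (f @` [set` H]).
Proof.
split=> [| _ _ [x Hx <-] [y Hy <-] | _ [x Hx <-]].
- by exists 1; [apply: group1 | apply: morph_one].
- by exists (x * y); [apply: groupM | apply: fM].
- by exists x^-1; [rewrite /= groupV | apply: morph_inv].
Qed.

Lemma gen_image (A : {set hT}) : gen (f @` [set` A]) = f @` [set` <<A>>].
Proof.
have [G1 GM GV] := gen_subgroup (f @` [set` A]).
apply/seteqP; split.
  apply: gen_sub (image_subgroup _) _ => _ [x Ax <-].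
  by exists x; rewrite //=; apply: mem_gen.
(* [K] is the preimage of the generated subgroup. As [hT] is finite, containing 1 and being closed
   under products suffice to make it a group. *)
pose K := [set x | `[<gen (f @` [set` A]) (f x)>]]%SET.
have gK : group_set K.
  apply/group_setP; split=> [|x y]; rewrite !inE; first by rewrite morph_one.
  by rewrite fM; apply: GM.
have sAK : <<A>> \subset Group gK.
  rewrite gen_subG; apply/fintype.subsetP => x Ax; rewrite inE.
  by apply/asboolP; apply: sub_gen; exists x.
by move=> _ [x /= Ax <-]; have := fintype.subsetP sAK x Ax; rewrite inE => /asboolP.
Qed.

End Morphism.

Lemma expg_modn (x : gT) p k : x ^+ p = 1 -> x ^+ (k %% p) = x ^+ k.
Proof.
by move=> xp; rewrite {2}(divn_eq k p) mulnC expgnDr expgnA xp expg1n mul1g.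
Qed.

Lemma expg_Zp8M (x : gT) : x ^+ 8 = 1 -> {morph (fun k : 'Z_8 => x ^+ k) : i j / i * j}.
Proof. by move=> x8 i j; rewrite -expgnDr -[RHS](expg_modn _ x8). Qed.

Lemma gen_cycle8 (x : gT) : x ^+ 8 = 1 -> gen [set x] = range (fun k : 'Z_8 => x ^+ k).
Proof.
move=> x8; have := gen_image (expg_Zp8M x8) [set Zp1]%SET.
have -> : [set` <<[set (Zp1 : 'Z_8)]>>%SET] = [set: 'Z_8].
  by apply/seteqP; split=> // k _ /=; rewrite -/(cycle Zp1) -Zp_cycle inE.
suff -> : [set` [set (Zp1 : 'Z_8)]%SET] = [set (Zp1 : 'Z_8)] by rewrite image_set1.
by apply/seteqP; split=> k /=; rewrite inE => /eqP.
Qed.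

(** Square repeatedly: the last of [x], [x ^+ 2], [x ^+ 4], ... that differs from 1 has square 1. *)
Lemma power_involution (x : gT) n : x ^+ (2 ^ n) = 1 -> x <> 1 ->
  exists2 m, x ^+ m <> 1 & (x ^+ m) ^+ 2 = 1.
Proof.
elim: n x => [|n IHn] x; first by rewrite expg1.
move=> xn x1; have [x2|x2] := pselect (x ^+ 2 = 1); first by exists 1%N; rewrite expg1.
have [|m] := IHn _ _ x2; first by rewrite -expgnA -expnS.
by rewrite -expgnA; exists (2 * m)%N.
Qed.

End GeneratedSubgroups.

(** * Affine permutations of Z/8 *)

Section AffinePermutations.

(* Multiplication by w ^ v depends only on the parity of v when w * w = 1, so
   the permutations i |-> w ^ v * i + v of Z/8 form a group of order 8; it
   contains s1 when w = 5, and s2 and s3 when w = 3. *)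
Definition affine (w : 'I_8) (s : 'S_8) :=
  [forall i : 'I_8, s i == (w ^+ s 0%R * i + s 0%R : 'I_8)].

Lemma affineP (w : 'I_8) (s : 'S_8) :
  reflect (forall i : 'I_8, s i = w ^+ s 0%R * i + s 0%R) (affine w s).
Proof. by apply: (iffP forallP) => h i; apply/eqP; rewrite h. Qed.

(** Turns a claim about Z/8 into eight closed boolean tests, which [vm_compute] can evaluate. *)
Lemma forall_I8 (p : 'I_8 -> bool) : all (p \o inZp) (iota 0 8) -> forall i, p i.
Proof.
by move/allP=> h i; rewrite -(valZpK i); apply: h; rewrite mem_iota ltn_ord.
Qed.

Lemma forall_I8_pair (p : 'I_8 -> 'I_8 -> bool) :
  all (fun m => all (p (inZp m) \o inZp) (iota 0 8)) (iota 0 8) -> forall i j, p i j.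
Proof.
move=> /(forall_I8 (p := fun i => all (p i \o inZp) (iota 0 8))) h i.
exact/forall_I8/h.
Qed.

Lemma affine_s1 : affine 5%:R s1.
Proof.
apply/affineP => i; apply/eqP; move: i; apply: forall_I8.
by rewrite /= !permE; vm_compute.
Qed.

Lemma affine_s2 : affine 3%:R s2.
Proof.
apply/affineP => i; apply/eqP; move: i; apply: forall_I8.
by rewrite /= !permM !permE; vm_compute.
Qed.

Lemma affine_s3 : affine 3%:R s3.
Proof.
apply/affineP => i; apply/eqP; move: i; apply: forall_I8.
by rewrite /= !permM !permE; vm_compute.
Qed.

Variables (w : 'I_8) (hw : w = 3%:R \/ w = 5%:R).

(** Only the parity of the exponent matters, and [w ^+ b * a + b] has the parity of [a + b] because
    [w] is odd. This identity closes the affine permutations under composition. *)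
Lemma affine_multM (a b : 'I_8) : w ^+ (w ^+ b * a + b)%R = w ^+ b * w ^+ a.
Proof.
by apply/eqP; move: b a; case: hw => ->; apply: forall_I8_pair; vm_compute.
Qed.

(** The left-hand side of the hypothesis is [s (s 0)] when [s 0 = v]. It is [2 * v] for even [v] and
    [(w + 1) * v] for odd [v]; the latter is nonzero modulo 8, as [w + 1] is 4 or 6. *)
Lemma affine_involution (v : 'I_8) : w ^+ v * v + v = 0 -> v = 0 \/ v = 4%:R.
Proof.
move/eqP=> h; suff: (v == 0) || (v == 4%:R) by case/orP=> /eqP; [left | right].
apply: implyP h; by move: v; case: hw => ->; apply: forall_I8; vm_compute.
Qed.

Lemma affine_group_set : group_set [set s | affine w s]%SET.
Proof.
apply/group_setP; split=> [|s t]; rewrite !inE.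
  by apply/affineP => i; rewrite !perm1 expr0 mul1r addr0.
move=> /affineP hs /affineP ht; apply/affineP => i.
rewrite !permM [t (s i)]ht [s i]hs [t (s 0)]ht affine_multM; ring.
Qed.

End AffinePermutations.

(** * The permutations [s1], [s2], [s3] and the groups they generate *)

Lemma s1E : s1 =1 (fun i : 'I_8 => 5%:R * i + 7%:R)%R.
Proof.
by move=> i; apply/eqP; move: i; apply: forall_I8; rewrite /= !permE; vm_compute.
Qed.

Lemma s2E : s2 =1 (fun i : 'I_8 => i + 2%:R)%R.
Proof.
by move=> i; apply/eqP; move: i; apply: forall_I8; rewrite /= !permM !permE; vm_compute.
Qed.

Lemma s3E : s3 =1 (fun i : 'I_8 => 3%:R * i + 1)%R.
Proof.
by move=> i; apply/eqP; move: i; apply: forall_I8; rewrite /= !permM !permE; vm_compute.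
Qed.

Section Permutations.
Local Open Scope group_scope.

Lemma s1_expg8 : s1 ^+ 8 = 1.
Proof.
apply/permP => i; rewrite permX perm1 (eq_iter s1E); apply/eqP; move: i.
by apply: forall_I8; vm_compute.
Qed.

Lemma s1_expg_inj : injective (fun k : 'Z_8 => s1 ^+ k).
Proof.
move=> k l /(congr1 (fun s : 'S_8 => s 0%R)); rewrite !permX !(eq_iter s1E).
move=> /eqP h; apply/eqP; apply: implyP h; move: k l.
by apply: forall_I8_pair; vm_compute.
Qed.

Let s2X n : s2 ^+ n =1 iter n (fun i : 'I_8 => i + 2%:R)%R.
Proof. by move=> i; rewrite permX (eq_iter s2E). Qed.

Let s3X n : s3 ^+ n =1 iter n (fun i : 'I_8 => 3%:R * i + 1)%R.
Proof. by move=> i; rewrite permX (eq_iter s3E). Qed.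

(** [s3] sends 0 to 1 and each [s2] adds 2, so [i] is rebuilt from its parity and its half. *)
Lemma s2_s3_transitive (i : 'I_8) : (s3 ^+ odd i * s2 ^+ i./2) 0%R = i.
Proof.
apply/eqP; rewrite permM s2X s3X; move: i.
by apply: forall_I8; vm_compute.
Qed.

(** The generators satisfy the presentation of the quaternion group, so they generate a quotient of
    it; the orbit of 0 has eight points, so the order is at least 8. *)
Lemma s2_s3_quaternion : <<[set s2; s3]>>%SET \isog 'Q_8.
Proof.
rewrite isogEcard (@card_quaternion 3) // (@Grp_quaternion 3) //; apply/andP; split.
  apply/existsP; exists (s2, s3); rewrite /= !xpair_eqE; apply/and4P; split=> //.
  - by rewrite /cycle joing_idl joing_idr.
  - apply/eqP/permP => i; rewrite s2X perm1; apply/eqP; move: i.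
    by apply: forall_I8; vm_compute.
  - apply/eqP/permP => i; rewrite s2X s3X; apply/eqP; move: i.
    by apply: forall_I8; vm_compute.
  (* The relation [s2 ^ s3 = s2^-1], in the inverse-free form [s2 * s3 * s2 = s3]. *)
  - apply/eqP/(mulgI s3); rewrite -conjgC; apply: (mulIg s2); rewrite mulgKV.
    apply/permP => i; rewrite (permM (s2 * s3)) (permM s2) !s2E !s3E; apply/eqP; move: i.
    by apply: forall_I8; vm_compute.
have -> : (2 ^ 3)%N = #|[set: 'I_8]%SET| by rewrite cardsT card_ord.
apply: leq_trans (leq_imset_card (fun s : 'S_8 => s 0%R) _).
apply/subset_leq_card/fintype.subsetP => i _; rewrite -(s2_s3_transitive i).
by apply: imset_f; rewrite groupM // groupX // mem_gen // !inE eqxx ?orbT.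
Qed.

Lemma mem_cycle_s1P (s : 'S_8) : s \in <[s1]> -> exists k : 'Z_8, s = s1 ^+ k.
Proof.
move=> /cycleP[k ->]; exists (inZp k).
by rewrite /= expg_mod ?s1_expg8.
Qed.

Lemma affine_cycle_s1 (s : 'S_8) : s \in <[s1]> -> affine 5%:R s.
Proof.
have gA := affine_group_set (or_intror (erefl (5%:R : 'I_8))).
have sA : <[s1]> \subset Group gA by rewrite cycle_subG inE affine_s1.
by move/(fintype.subsetP sA); rewrite inE.
Qed.

Lemma affine_gen_s2_s3 (s : 'S_8) : s \in <<[set s2; s3]>>%SET -> affine 3%:R s.
Proof.
have gA := affine_group_set (or_introl (erefl (3%:R : 'I_8))).
have sA : <<[set s2; s3]>>%SET \subset Group gA.
  by rewrite gen_subG finset.subUset !finset.sub1set !inE affine_s2 affine_s3.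
by move/(fintype.subsetP sA); rewrite inE.
Qed.

Lemma affine_involutionE (w : 'I_8) (s : 'S_8) : w = 3%:R \/ w = 5%:R ->
  affine w s -> s ^+ 2 = 1 -> s = 1 \/ forall i : 'I_8, s i = (i + 4%:R)%R.
Proof.
move=> hw As; rewrite expg2 => /(congr1 (fun t : 'S_8 => t 0%R)); rewrite permM perm1.
rewrite (affineP _ _ As) => /affine_involution; case=> // e; [left | right].
  by apply/permP => i; rewrite (affineP _ _ As) e expr0 mul1r addr0 perm1.
move=> i; rewrite (affineP _ _ As) e; apply/eqP; move: i.
by case: hw => ->; apply: forall_I8; vm_compute.
Qed.

End Permutations.

(** * Commutation of [tau] with coordinate permutations *)

Section MonomialGroup.
Variables (F : fieldType) (z : F) (hz : 8.-primitive_root z).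
Local Notation t := (tau hz).
Local Notation p := (@proj_perm F).

Lemma proj_permM : {morph p : s u / (s * u)%g}.
Proof.
move=> s u; have uM : perm_mx s *m perm_mx u \in @unitmx F 8.
  by rewrite unitmx_mul !unitmx_perm.
transitivity (PGL_mx uM); last exact/esym/PGL_mulE.
by apply/PGL_mxP; exists 1; rewrite ?oner_neq0 // scale1r perm_mxM.
Qed.

Lemma tauX_unitmx n : diag_mx (\row_(i < 8) z ^- (n * i)) \in unitmx.
Proof.
have z0 : z != 0 by rewrite (prim_root_eq0 hz).
rewrite unitmxE unitfE det_diag; apply/prodf_neq0 => i _.
by rewrite mxE invr_eq0 expf_neq0.
Qed.

Lemma tauX n : (t ^+ n)%g = PGL_mx (tauX_unitmx n).
Proof.
elim: n => [|n IHn].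
  rewrite expg0; apply/PGL_mxP; exists 1; rewrite ?oner_neq0 // scale1r -diag_const_mx.
  by congr diag_mx; apply/rowP => i; rewrite !mxE mul0n expr0 invr1.
rewrite expgS IHn.
have uM : diag_mx (\row_(i < 8) z ^- i) *m diag_mx (\row_(i < 8) z ^- (n * i)) \in unitmx.
  by rewrite unitmx_mul tau_unitmx // tauX_unitmx.
transitivity (PGL_mx uM); first exact: PGL_mulE.
apply/PGL_mxP; exists 1; rewrite ?oner_neq0 // scale1r mulmx_diag.
congr diag_mx; apply/rowP => i; rewrite !mxE mulSn exprD invfM //.
Qed.

Lemma tau_expg8 : (t ^+ 8)%g = 1%g.
Proof.
rewrite tauX; apply/PGL_mxP; exists 1; rewrite ?oner_neq0 // scale1r.
apply/matrixP => i j; rewrite !mxE exprM (prim_expr_order hz) expr1n invr1.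
by [].
Qed.

(** Replacing [i] by [u * i + v] in the weight [n * i] multiplies its linear part by [u] and adds
    the constant [n * v], which contributes a mere scalar, trivial in PGL. *)
Lemma proj_perm_tau (s : 'S_8) (u v : 'I_8) n : (forall i : 'I_8, s i = u * i + v) ->
  (p s * t ^+ n = t ^+ (n * u) * p s)%g.
Proof.
move=> su; rewrite !tauX.
have uL : perm_mx s *m diag_mx (\row_(i < 8) z ^- (n * i)) \in unitmx.
  by rewrite unitmx_mul unitmx_perm tauX_unitmx.
have uR : diag_mx (\row_(i < 8) z ^- (n * u * i)) *m perm_mx s \in unitmx.
  by rewrite unitmx_mul unitmx_perm tauX_unitmx.
transitivity (PGL_mx uL); first exact: PGL_mulE.
transitivity (PGL_mx uR); last exact/esym/PGL_mulE.
have z0 : z != 0 by rewrite (prim_root_eq0 hz).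
apply/PGL_mxP; exists (z ^+ (n * v)); first by rewrite expf_neq0.
apply/matrixP => i j; rewrite mul_mx_diag mul_diag_mx !mxE.
case: eqVneq => [<-|_]; last by rewrite ?(mulr0, mul0r).
have zn8 : (z ^+ n) ^+ 8 = 1 by rewrite exprAC (prim_expr_order hz) expr1n.
(* Here [u * i + v] is reduced modulo 8; this is harmless because [z ^+ n] has eighth power 1. *)
have e : z ^+ (n * (u * i + v)%R) = z ^+ (n * v) * z ^+ (n * u * i).
  rewrite [in LHS]exprM (expr_mod _ zn8) exprD (expr_mod _ zn8) -!exprM.
  by rewrite mulnA mulrC.
by rewrite su e mulr1 mul1r invfM mulrA mulfV ?mul1r // expf_neq0.
Qed.

(** Off-diagonal entries of a diagonal matrix vanish, so [s] is trivial; the diagonal entries at 0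
    and 1 then give [z ^+ n = 1]. *)
Lemma tau_perm_indep (s : 'S_8) n : (t ^+ n)%g = p s -> s = 1%g /\ (8 %| n)%N.
Proof.
rewrite tauX => /PGL_mxP[c c0 /matrixP e].
have z0 : z != 0 by rewrite (prim_root_eq0 hz).
have s1 : s = 1%g.
  apply/permP => i; rewrite perm1; move: (e i (s i)); rewrite !mxE eqxx.
  case: eqVneq => [//|_]; rewrite mulr0n mulr0 => /eqP; rewrite oner_eq0 //.
split=> //; move: (e 0 0) (e 1 1); rewrite s1 !mxE !perm1 !eqxx !mulr1n.
rewrite muln0 expr0 invr1 mulr1 => <-; rewrite mul1r muln1 => /esym/eqP.
by rewrite invr_eq1 (prim_order_dvd hz).
Qed.

End MonomialGroup.

(** * Internal semidirect products *)

Section InternalSemidirect.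
Variable gT : groupType.
Implicit Types S T N H : set gT.
Local Open Scope group_scope.

(** The products form a subgroup because [(x * y) * (x' * y') = (x * (y * x' * y^-1)) * (y * y')];
    it contains both generating sets, hence is the whole generated group. *)
Lemma sdprod_gen S T :
    (forall x y, gen S x -> gen T y -> gen S (y * x * y^-1)) ->
    (forall x, gen S x -> gen T x -> x = 1) ->
  is_sdprod (gen (S `|` T)) (gen S) (gen T).
Proof.
move=> nST tiST.
have [N1 NM NV] := gen_subgroup S; have [H1 HM HV] := gen_subgroup T.
have [G1 GM GV] := gen_subgroup (S `|` T).
have sNG : gen S `<=` gen (S `|` T).
  by apply: gen_sub (gen_subgroup _) _ => x Sx; apply: sub_gen; left.
have sHG : gen T `<=` gen (S `|` T).
  by apply: gen_sub (gen_subgroup _) _ => x Tx; apply: sub_gen; right.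
have nST' x y : gen S x -> gen T y -> gen S (y^-1 * x * y).
  by move=> Sx /HV Ty; have := nST _ _ Sx Ty; rewrite invgK.
have NH : [set x * y | x in gen S & y in gen T] = gen (S `|` T).
  apply/seteqP; split=> [_ [x Nx [y Hy <-]] | ].
    by apply: GM; [apply: sNG | apply: sHG].
  apply: gen_sub => [|x [Sx|Tx]]; last 2 first.
  - by exists x; [apply: sub_gen | exists 1; rewrite ?mulg1].
  - by exists 1 => //; exists x; [apply: sub_gen | rewrite mul1g].
  split=> [| _ _ [x Nx [y Hy <-]] [x' Nx' [y' Hy' <-]] | _ [x Nx [y Hy <-]]].
  - by exists 1 => //; exists 1; rewrite ?mulg1.
  - exists (x * (y * x' * y^-1)); first by apply: NM => //; apply: nST.
    by exists (y * y'); [apply: HM | rewrite !mulgA mulgKV].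
  - exists (y^-1 * x^-1 * y); first by apply: nST' => //; apply: NV.
    by exists y^-1; [apply: HV | rewrite mulgK invgM].
split=> //; last first.
  by apply/seteqP; split=> [x [] | x ->]; [apply: tiST | split].
split=> // x g Nx; rewrite -NH => -[n Nn [h Hh <-]].
have -> : (n * h)^-1 * x * (n * h) = h^-1 * (n^-1 * x * n) * h by rewrite invgM !mulgA.
by apply: nST' => //; apply: (NM) => //; apply: (NM) => //; apply: NV.
Qed.

End InternalSemidirect.

(** * Groups generated by [tau] and affine permutations *)

Section SemidirectInPGL.
Variables (F : fieldType) (z : F) (hz : 8.-primitive_root z).
Local Notation t := (tau hz).
Local Notation p := (@proj_perm F).
Local Open Scope group_scope.

Lemma gen_tauP g : gen [set t] g <-> exists n, g = t ^+ n.
Proof.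
split; first by rewrite (gen_cycle8 (tau_expg8 hz)) => -[k _ <-]; exists k.
by move=> [n ->]; apply: subgroupX (gen_subgroup _) _; apply: sub_gen.
Qed.

Lemma proj_perm_inj : injective p.
Proof.
move=> s u e; have := @tau_perm_indep F z hz (s * u^-1) 0.
rewrite expg0 proj_permM e -proj_permM mulgV (morph_one (@proj_permM F)).
by case=> // /eqP; rewrite -eq_mulgV1 => /eqP.
Qed.

Variables (w : 'I_8) (A : {set 'S_8}).
Hypothesis affA : {in <<A>>%SET, forall s, affine w s}.

Lemma gen_tau_perm :
  is_sdprod (gen ([set t] `|` p @` [set` A])) (gen [set t]) (gen (p @` [set` A])).
Proof.
apply: sdprod_gen => [_ g /gen_tauP[n ->] | _ /gen_tauP[n ->]].
  rewrite (gen_image (@proj_permM F)) => -[s /= As <-].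
  rewrite (proj_perm_tau hz n (affineP _ _ (affA As))) mulgK.
  by apply/gen_tauP; eexists.
rewrite (gen_image (@proj_permM F)) => -[s /= As e].
have [s1 _] := tau_perm_indep (esym e).
by rewrite -e s1 (morph_one (@proj_permM F)).
Qed.

Lemma gen_tau_permP g : gen ([set t] `|` p @` [set` A]) g ->
  exists n s, s \in <<A>>%SET /\ g = t ^+ n * p s.
Proof.
have [_ _ <- _] := gen_tau_perm; case=> x /gen_tauP[n ->] [y + <-].
by rewrite (gen_image (@proj_permM F)) => -[s As <-]; exists n, s.
Qed.

(** An eighth power kills the permutation, whose group has order 8, and leaves a power of [tau],
    which a second eighth power kills. The form [2 ^ 6] suits [power_involution]. *)
Lemma gen_tau_perm_exp64 g : #|<<A>>%SET| = 8 ->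
  gen ([set t] `|` p @` [set` A]) g -> g ^+ (2 ^ 6) = 1.
Proof.
move=> A8 /gen_tau_permP[n [s [As ->]]].
suff pX k : exists m, (t ^+ n * p s) ^+ k = t ^+ m * p (s ^+ k).
  have [m e] := pX 8; rewrite (_ : 2 ^ 6 = 8 * 8)%N // expgnA e.
  have -> : s ^+ 8 = 1 by apply/eqP; rewrite -order_dvdn (dvdn_trans (order_dvdG As)) // A8.
  by rewrite (morph_one (@proj_permM F)) mulg1 expgnAC tau_expg8 expg1n.
elim: k => [|k [m e]].
  by exists 0; rewrite !expg0 (morph_one (@proj_permM F)) mulg1.
exists (n + m * (w ^+ s 0%R)%R)%N; rewrite !expgS e proj_permM expgnDr !mulgA.
congr (_ * _); rewrite -!mulgA; congr (_ * _).
exact: proj_perm_tau (affineP _ _ (affA As)).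
Qed.

(** Squaring forces [s ^+ 2 = 1], so [s] is the translation by 0 or 4. Its multiplier is then 1, the
    square is [t ^+ (2 * n)], and [8 %| 2 * n] gives [4 %| n]. *)
Lemma gen_tau_perm_involution g : w = 3%:R%R \/ w = 5%:R%R ->
    gen ([set t] `|` p @` [set` A]) g -> g ^+ 2 = 1 ->
  exists n s, [/\ g = t ^+ (4 * n) * p s,
    s \in <<A>>%SET & s = 1 \/ forall i : 'I_8, s i = (i + 4%:R)%R].
Proof.
move=> hw /gen_tau_permP[n [s [As ->]]]; have affs := affA As.
have sq (u v : 'I_8) : (forall i : 'I_8, s i = (u * i + v)%R) ->
    (t ^+ n * p s) ^+ 2 = t ^+ (n + n * u) * p (s ^+ 2).
  move=> /(proj_perm_tau hz n) e.
  by rewrite !expg2 proj_permM expgnDr -!mulgA; congr (_ * _); rewrite !mulgA e.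
have ts1 (u v : 'I_8) : (forall i : 'I_8, s i = (u * i + v)%R) ->
    (t ^+ n * p s) ^+ 2 = 1 -> s ^+ 2 = 1 /\ (8 %| n + n * u)%N.
  move=> /sq -> e; have [|s21 ->] := @tau_perm_indep F z hz (s ^+ 2)^-1 (n + n * u).
    by rewrite (morph_inv (@proj_permM F)) -[RHS]mul1g -e mulgK.
  by split=> //; rewrite -[s ^+ 2]invgK s21 invg1.
move=> e; have [s2 _] := ts1 _ _ (affineP _ _ affs) e.
have s14 := affine_involutionE hw affs s2.
suff /dvdnP[k nk] : (4 %| n)%N by exists k, s; rewrite nk mulnC.
have [v sv] : exists v : 'I_8, forall i : 'I_8, s i = (1 * i + v)%R.
  case: s14 => [-> | s4]; first by exists 0%R => i; rewrite perm1 mul1r addr0.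
  by exists 4%:R%R => i; rewrite s4 mul1r.
have [_] := ts1 _ _ sv e; rewrite (_ : n + n * 1%R = 2 * n)%N; last by rewrite mulSn mul1n muln1.
by rewrite (_ : 8 = 2 * 4)%N // dvdn_pmul2l.
Qed.

End SemidirectInPGL.

(** * The action on points and the invariance of [V8] *)

Section FreeAction.
Variables (F : fieldType) (z : F) (hz : 8.-primitive_root z).
Local Notation t := (tau hz).
Local Notation p := (@proj_perm F).

Lemma proj_act1 (q : proj F 7) : proj_act 1%g q = q.
Proof.
elim/proj_ptW: q => x x0; have x0' : 1%:M *m x != 0 by rewrite mul1mx.
transitivity (proj_pt x0'); first exact: proj_actE.
by apply/proj_ptP; exists 1; rewrite ?oner_neq0 // scale1r mul1mx.
Qed.

Lemma proj_actM (g h : PGL F 7) (q : proj F 7) :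
  proj_act (g * h)%g q = proj_act g (proj_act h q).
Proof.
elim/proj_ptW: q => x x0; elim/PGL_mxW: g => A uA; elim/PGL_mxW: h => B uB.
have uAB : A *m B \in unitmx by rewrite unitmx_mul uA.
have Bx0 : B *m x != 0 .
  by apply: contraNneq x0 => e; rewrite -(mulKmx uB x) e mulmx0.
have ABx0 : A *m (B *m x) != 0 .
  by apply: contraNneq Bx0 => e; rewrite -(mulKmx uA (B *m x)) e mulmx0.
have ABx0' : A *m B *m x != 0 by rewrite -mulmxA.
rewrite (proj_actE uB x0 Bx0) (proj_actE uA Bx0 ABx0).
have -> : (PGL_mx uA * PGL_mx uB)%g = PGL_mx uAB by exact: PGL_mulE.
rewrite (proj_actE uAB x0 ABx0'); apply/proj_ptP.
by exists 1; rewrite ?oner_neq0 // scale1r mulmxA.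
Qed.

Lemma proj_act_fixX (g : PGL F 7) (q : proj F 7) n :
  proj_act g q = q -> proj_act (g ^+ n)%g q = q.
Proof.
by move=> gq; elim: n => [|n IHn]; rewrite ?expg0 ?proj_act1 // expgS proj_actM IHn.
Qed.

Definition monomial n (s : 'S_8) (x : 'cV[F]_8) : 'cV[F]_8 :=
  \col_i (z ^- (n * i) * x (s i) 0).

Lemma monomial_neq0 n s x : x != 0 -> monomial n s x != 0.
Proof.
move=> x0; apply: contraNneq x0 => /colP e; apply/eqP/colP => i.
have := e ((s^-1)%g i); rewrite !mxE permKV => /eqP; rewrite mulf_eq0 invr_eq0 expf_eq0.
by rewrite (prim_root_eq0 hz) andbF => /eqP.
Qed.

Lemma proj_act_tau_perm n s (x : 'cV[F]_8) (x0 : x != 0) :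
  proj_act (t ^+ n * p s)%g (proj_pt x0) = proj_pt (monomial_neq0 n s x0).
Proof.
rewrite tauX.
have uM : diag_mx (\row_(i < 8) z ^- (n * i)) *m perm_mx s \in unitmx.
  by rewrite unitmx_mul tauX_unitmx // unitmx_perm.
have -> : (PGL_mx (tauX_unitmx hz n) * p s)%g = PGL_mx uM by exact: PGL_mulE.
have e : monomial n s x = diag_mx (\row_(i < 8) z ^- (n * i)) *m perm_mx s *m x.
  apply/colP => i; rewrite -mulmxA mul_diag_mx -row_permE !mxE //.
have Mx0 : diag_mx (\row_(i < 8) z ^- (n * i)) *m perm_mx s *m x != 0.
  by rewrite -e monomial_neq0.
rewrite (proj_actE uM x0 Mx0); apply/proj_ptP.
by exists 1; rewrite ?oner_neq0 // scale1r e.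
Qed.

(** The indices 0 to 3 give the four equations of [V8], and [i + 4] gives the same polynomial as
    [i]. Indexing by all of Z/8 lets an affine permutation act by a change of index. *)
Definition quadric (y : 'cV[F]_3) (x : 'cV[F]_8) (i : 'I_8) : F :=
  let y1 := y 0 0 in let y2 := y 1 0 in let y3 := y 2%R 0 in
  y1 * y3 * (x i 0 ^+ 2 + x (i + 4%:R) 0 ^+ 2)
  - y2 ^+ 2 * (x (i + 1) 0 * x (i + 7%:R) 0 + x (i + 3%:R) 0 * x (i + 5%:R) 0)
  + (y1 ^+ 2 + y3 ^+ 2) * (x (i + 2%:R) 0 * x (i + 6%:R) 0).

Lemma V8_quadric (y : 'cV[F]_3) (x : 'cV[F]_8) (x0 : x != 0) :
  V8 y (proj_pt x0) <-> forall i, quadric y x i = 0.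
Proof.
have inZpD j k : inZp j + inZp k = inZp (j + k) :> 'I_8.
  by apply: val_inj; apply: modnDm.
have inZp8 k : inZp k.+4.+4 = inZp k :> 'I_8.
  by apply: val_inj; rewrite /= -[k.+4.+4]/(8 + k)%N modnDl.
have quadric_inZp k : quadric y x (inZp k) =
    let y1 := y 0 0 in let y2 := y 1 0 in let y3 := y 2%R 0 in
    y1 * y3 * (x (inZp k) 0 ^+ 2 + x (inZp (k + 4)) 0 ^+ 2)
    - y2 ^+ 2 * (x (inZp (k + 1)) 0 * x (inZp (k + 7)) 0
                 + x (inZp (k + 3)) 0 * x (inZp (k + 5)) 0)
    + (y1 ^+ 2 + y3 ^+ 2) * (x (inZp (k + 2)) 0 * x (inZp (k + 6)) 0).
  rewrite /quadric (_ : 1 = inZp 1 :> 'I_8); last exact: val_inj.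
  by rewrite !Zp_nat !inZpD.
rewrite V8P; split=> [[e0 e1 e2 e3] i | e].
  rewrite -(valZpK i); case: i => -[|[|[|[|[|[|[|[|//]]]]]]]] i8; rewrite [val _]/=.
  - by rewrite quadric_inZp -[RHS]e0 /=; ring.
  - by rewrite quadric_inZp -[RHS]e1 /= !inZp8; ring.
  - by rewrite quadric_inZp -[RHS]e2 /= !inZp8; ring.
  - by rewrite quadric_inZp -[RHS]e3 /= !inZp8; ring.
  - by rewrite quadric_inZp -[RHS]e0 /= !inZp8; ring.
  - by rewrite quadric_inZp -[RHS]e1 /= !inZp8; ring.
  - by rewrite quadric_inZp -[RHS]e2 /= !inZp8; ring.
  - by rewrite quadric_inZp -[RHS]e3 /= !inZp8; ring.
have Q k := etrans (esym (quadric_inZp k)) (e (inZp k)).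
split.
- by rewrite -[RHS](Q 0); ring.
- by rewrite -[RHS](Q 1) /= !inZp8; ring.
- by rewrite -[RHS](Q 2) /= !inZp8; ring.
- by rewrite -[RHS](Q 3) /= !inZp8; ring.
Qed.

(** In each monomial the two offsets from [i] add up to 0 modulo 8, so all terms acquire the same
    weight. Multiplication by 3 or 5 exchanges the offset pairs {1,7} and {3,5} and preserves {0},
    {4} and {2,6}. *)
Lemma quadric_monomial n (s : 'S_8) (u v : 'I_8) y x i :
    u \in [:: 1; 3%:R; 5%:R] -> (forall j : 'I_8, s j = u * j + v) ->
  quadric y (monomial n s x) i = (z ^- (n * i)) ^+ 2 * quadric y x (s i).
Proof.
move=> hu su; pose e (j : 'I_8) : F := z ^- (n * j).
have eD j k : e (j + k) = e j * e k.
  have zn8 : (z ^+ n) ^+ 8 = 1 by rewrite exprAC (prim_expr_order hz) expr1n.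
  by rewrite /e !exprM (expr_mod _ zn8) exprD invfM.
have e_opp k l : k + l = 0 -> e k * e l = 1.
  by move=> kl; rewrite -eD kl /e muln0 expr0 invr1.
have e44 : e 4%:R * e 4%:R = 1 by apply: e_opp; apply: val_inj.
have e17 : e 1 * e 7%:R = 1 by apply: e_opp; apply: val_inj.
have e35 : e 3%:R * e 5%:R = 1 by apply: e_opp; apply: val_inj.
have e26 : e 2%:R * e 6%:R = 1 by apply: e_opp; apply: val_inj.
have sD j : s (i + j) = s i + u * j by rewrite !su mulrDr addrAC.
have QM a b c d X X4 X1 X7 X3 X5 X2 X6 : let E := e i in
  a * ((E * X) ^+ 2 + (E * e 4%:R * X4) ^+ 2)
   - b * (E * e 1 * X1 * (E * e 7%:R * X7) + E * e 3%:R * X3 * (E * e 5%:R * X5))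
   + (c + d) * (E * e 2%:R * X2 * (E * e 6%:R * X6))
  = E ^+ 2 * (a * (X ^+ 2 + X4 ^+ 2) - b * (X1 * X7 + X3 * X5) + (c + d) * (X2 * X6)).
  rewrite /=; ring: e44 e17 e35 e26.
have M j : monomial n s x j 0 = e j * x (s j) 0 by rewrite mxE.
rewrite /quadric !M !(eD i) !sD QM -/(e i); congr (_ * _).
move: hu; rewrite !inE => /or3P[] /eqP ->.
- by rewrite !mul1r.
- have -> : 3%:R * 4%:R = 4%:R :> 'I_8 by exact: val_inj.
  have -> : 3%:R * 1 = 3%:R :> 'I_8 by exact: val_inj.
  have -> : 3%:R * 7%:R = 5%:R :> 'I_8 by exact: val_inj.
  have -> : 3%:R * 3%:R = 1 :> 'I_8 by exact: val_inj.
  have -> : 3%:R * 5%:R = 7%:R :> 'I_8 by exact: val_inj.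
  have -> : 3%:R * 2%:R = 6%:R :> 'I_8 by exact: val_inj.
  have -> : 3%:R * 6%:R = 2%:R :> 'I_8 by exact: val_inj.
  by ring.
- have -> : 5%:R * 4%:R = 4%:R :> 'I_8 by exact: val_inj.
  have -> : 5%:R * 1 = 5%:R :> 'I_8 by exact: val_inj.
  have -> : 5%:R * 7%:R = 3%:R :> 'I_8 by exact: val_inj.
  have -> : 5%:R * 3%:R = 7%:R :> 'I_8 by exact: val_inj.
  have -> : 5%:R * 5%:R = 1 :> 'I_8 by exact: val_inj.
  have -> : 5%:R * 2%:R = 2%:R :> 'I_8 by exact: val_inj.
  have -> : 5%:R * 6%:R = 6%:R :> 'I_8 by exact: val_inj.
  by ring.
Qed.

Lemma V8_tau_perm (w : 'I_8) (s : 'S_8) n y q : w = 3%:R \/ w = 5%:R -> affine w s ->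
  V8 y q -> V8 y (proj_act (t ^+ n * p s)%g q).
Proof.
elim/proj_ptW: q => x x0 hw /affineP su; rewrite proj_act_tau_perm !V8_quadric => Vx i.
(* As 3 and 5 square to 1 modulo 8, each power of [w] is 1 or [w]. *)
have hu : w ^+ s 0%R \in [:: 1; 3%:R; 5%:R].
  by move: (s 0%R); case: hw => ->; apply: forall_I8; vm_compute.
by rewrite (quadric_monomial _ _ _ _ hu su) Vx mulr0.
Qed.

End FreeAction.

(** The factors up to [4 a^2 + b^2] serve [tau4_fixed]. The others serve [translation_fixed]:
    [e * e' = 1] needs [2 a - b] and [(2 a + b)^4 - 16 c^4], and [e * e' = -1] needs the remaining
    two. *)
Definition discriminant (R : comNzRingType) (a b c : R) : R :=
  a * b * c * (4%:R * a ^+ 2 + b ^+ 2) * (2%:R * a - b) * (2%:R * a + b)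
  * ((2%:R * a + b) ^+ 4 - 16%:R * c ^+ 4) * ((2%:R * a - b) ^+ 4 + 16%:R * c ^+ 4).

(** * Elimination on the eigenspaces of the three involutions *)

Section FixedPoints.
Variable F : fieldType.

(* The quadrics at x4 = e x0, x6 = e x2, x5 = e' x1, x7 = e' x3: the case e = e'
   comes from kappa and the case e = - e' from tau^4 * kappa. *)
Lemma translation_fixed (a b c e e' x0 x1 x2 x3 : F) :
    e ^+ 2 = 1 -> e' ^+ 2 = 1 -> 2%:R * a - e * e' * b != 0 ->
    (2%:R * a + e * e' * b) ^+ 4 - e * e' * (16%:R * c ^+ 4) != 0 ->
    2%:R * a * x0 ^+ 2 - 2%:R * c * e' * x1 * x3 + b * e * x2 ^+ 2 = 0 ->
    2%:R * a * x1 ^+ 2 - 2%:R * c * x0 * x2 + b * e' * x3 ^+ 2 = 0 ->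
    2%:R * a * x2 ^+ 2 - 2%:R * c * x1 * x3 + b * e * x0 ^+ 2 = 0 ->
    2%:R * a * x3 ^+ 2 - 2%:R * c * e * x0 * x2 + b * e' * x1 ^+ 2 = 0 ->
  [/\ x0 = 0, x1 = 0, x2 = 0 & x3 = 0].
Proof.
move=> e2 e'2 nz nz4 q0 q1 q2 q3.
set A := 2%:R * a + _ in nz4.
(* Subtracting [e'] times [q2] from [q0] cancels the terms in [c] and leaves [2 a - e e' b] times
   [x0^2 - e' x2^2]; [q1] and [q3] are combined likewise. *)
have x02 : x0 ^+ 2 = e' * x2 ^+ 2.
  apply/eqP; rewrite -subr_eq0 -(mulrI_eq0 _ (mulfI nz)); apply/eqP.
  have := congr2 (fun u v => u - e' * v) q0 q2; rewrite mulr0 subr0 => <-.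
  by ring: e'2.
have x13 : x3 ^+ 2 = e * x1 ^+ 2.
  apply/eqP; rewrite -subr_eq0 -(mulrI_eq0 _ (mulfI nz)); apply/eqP.
  have := congr2 (fun u v => v - e * u) q1 q3; rewrite mulr0 subr0 => <-.
  by ring: e2.
have x20 : x2 ^+ 2 = e' * x0 ^+ 2 by rewrite x02 mulrA -expr2 e'2 mul1r.
have h0 : A * x0 ^+ 2 = 2%:R * c * e' * (x1 * x3).
  by apply/eqP; rewrite -subr_eq0 -[0 in X in _ == X]q0 x20 /A; apply/eqP; ring.
have h1 : A * x1 ^+ 2 = 2%:R * c * (x0 * x2).
  by apply/eqP; rewrite -subr_eq0 -[0 in X in _ == X]q1 x13 /A; apply/eqP; ring.
(* Squaring [h0] and [h1] eliminates [x2] and [x3]; what remains is linear in [x0 ^+ 4] and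
   [x1 ^+ 4]. *)
have s0 : A ^+ 2 * x0 ^+ 4 = 4%:R * c ^+ 2 * e * x1 ^+ 4.
  rewrite -[4%N]/(2 * 2)%N !exprM -exprMn h0 !exprMn x13 e'2; ring.
have s1 : A ^+ 2 * x1 ^+ 4 = 4%:R * c ^+ 2 * e' * x0 ^+ 4.
  rewrite -[4%N]/(2 * 2)%N !exprM -exprMn h1 !exprMn x20; ring.
(* The determinant of this linear system is [A^4 - 16 e e' c^4], nonzero by [nz4]. *)
have zero x y u v : u * v = e * e' -> A ^+ 2 * x ^+ 4 = 4%:R * c ^+ 2 * u * y ^+ 4 ->
    A ^+ 2 * y ^+ 4 = 4%:R * c ^+ 2 * v * x ^+ 4 -> x = 0.
  move=> uv hx hy; apply/eqP; suff : x ^+ 4 == 0 by rewrite expf_eq0.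
  rewrite -(mulrI_eq0 _ (mulfI nz4)) -uv; apply/eqP.
  transitivity (A ^+ 2 * (A ^+ 2 * x ^+ 4 - 4%:R * c ^+ 2 * u * y ^+ 4)
      + 4%:R * c ^+ 2 * u * (A ^+ 2 * y ^+ 4 - 4%:R * c ^+ 2 * v * x ^+ 4)); first by ring.
  by rewrite hx hy !subrr !mulr0 addr0.
have x00 : x0 = 0 by apply: zero s0 s1.
have x10 : x1 = 0 by apply: zero s1 s0; rewrite mulrC.
split=> //; apply/eqP.
  by have := x20; rewrite x00 expr0n mulr0 => /eqP; rewrite expf_eq0.
by have := x13; rewrite x10 expr0n mulr0 => /eqP; rewrite expf_eq0.
Qed.

(** The eigenspaces of [tau ^+ 4] are the even and the odd coordinates, and the quadrics take this
    shape on both. The last two equations combine to [(x0 + x4) * (x2 + x6) = 0] and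
    [(x0 - x4) * (x2 - x6) = 0]: either a pair vanishes, or one pair is equal and the other
    opposite. *)
Lemma tau4_fixed (a b c x0 x2 x4 x6 : F) : 2%:R != 0 :> F ->
    a != 0 -> b != 0 -> c != 0 -> 4%:R * a ^+ 2 + b ^+ 2 != 0 ->
    a * (x0 ^+ 2 + x4 ^+ 2) + b * (x2 * x6) = 0 ->
    a * (x2 ^+ 2 + x6 ^+ 2) + b * (x0 * x4) = 0 ->
    c * (x0 * x2 + x4 * x6) = 0 -> c * (x2 * x4 + x0 * x6) = 0 ->
  [/\ x0 = 0, x2 = 0, x4 = 0 & x6 = 0].
Proof.
move=> n2 na nb nc nd q0 q2 /eqP; rewrite mulf_eq0 (negPf nc) /= => /eqP r.
move=> /eqP; rewrite mulf_eq0 (negPf nc) /= => /eqP r'.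
(* A linear system in the squares, with determinant [4 a^2 + b^2]. *)
have sq0 x y : a * (x ^+ 2 + x ^+ 2) + b * y ^+ 2 = 0 ->
    a * (y ^+ 2 + y ^+ 2) - b * x ^+ 2 = 0 -> x = 0 /\ y = 0.
  move=> e e'; have x0' : x = 0.
    apply/eqP; suff : x ^+ 2 == 0 by rewrite expf_eq0.
    rewrite -(mulrI_eq0 _ (mulfI nd)).
    have := congr2 (fun u v => 2%:R * a * u - b * v) e e'.
    by rewrite !mulr0 subr0 => <-; apply/eqP; ring.
  split=> //; have /eqP : b * y ^+ 2 = 0 by rewrite -[RHS]e x0'; ring.
  by rewrite mulf_eq0 (negPf nb) expf_eq0 => /eqP.
have prod0 x y : a * (x ^+ 2 + y ^+ 2) = 0 -> b * (x * y) = 0 -> x = 0 /\ y = 0.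
  move=> /eqP + /eqP; rewrite !mulf_eq0 (negPf na) (negPf nb) /= => /eqP e /orP[]/eqP z.
    by move: e; rewrite z expr0n add0r => /eqP; rewrite expf_eq0 => /eqP.
  by move: e; rewrite z expr0n addr0 => /eqP; rewrite expf_eq0 => /eqP.
have twice (x : F) : x + x = 0 -> x = 0.
  by rewrite -mulr2n -mulr_natl => /eqP; rewrite mulf_eq0 (negPf n2) => /eqP.
have /eqP : (x0 + x4) * (x2 + x6) = 0.
  by have := congr2 +%R r r'; rewrite addr0 => <-; ring.
have /eqP : (x0 - x4) * (x2 - x6) = 0.
  by have := congr2 (fun u v => u - v) r r'; rewrite subr0 => <-; ring.
rewrite !mulf_eq0 !addr_eq0 !opprK => /orP[]/eqP e /orP[]/eqP e'.
- have x40 : x4 = 0 by apply: twice; rewrite -{1}e e' addNr.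
  have x00 : x0 = 0 by rewrite e x40.
  have [||-> ->] := prod0 x2 x6 _ _ => //.
  + by rewrite -[RHS]q2 x00; ring.
  + by rewrite -[RHS]q0 x00 x40; ring.
- subst x0 x2; have [||-> ->] := sq0 x6 x4; last by rewrite oppr0.
  + by rewrite -[RHS]q2; ring.
  + by rewrite -[RHS]q0; ring.
- subst x0 x2; have [||-> ->] := sq0 x4 x6; last by rewrite oppr0.
  + by rewrite -[RHS]q0; ring.
  + by rewrite -[RHS]q2; ring.
- have x60 : x6 = 0 by apply: twice; rewrite -{1}e e' addNr.
  have x20 : x2 = 0 by rewrite e x60.
  have [||-> ->] := prod0 x0 x4 _ _ => //.
  + by rewrite -[RHS]q0 x20; ring.
  + by rewrite -[RHS]q2 x20 x60; ring.
Qed.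
End FixedPoints.

(** * Freeness of the action on [V8] *)

Section Freeness.
Variables (F : fieldType) (z : F) (hz : 8.-primitive_root z).
Local Notation t := (tau hz).
Local Notation p := (@proj_perm F).

Definition generic (y : 'cV[F]_3) :=
  discriminant (y 0 0 * y 2%R 0) (y 0 0 ^+ 2 + y 2%R 0 ^+ 2) (y 1 0 ^+ 2) != 0.

Lemma prim8_expr4 : z ^+ 4 = -1.
Proof.
have /eqP : z ^+ 4 ^+ 2 = 1 by rewrite -exprM (prim_expr_order hz).
by rewrite sqrf_eq1 -(prim_order_dvd hz) => /orP[//|/eqP].
Qed.

(** In characteristic 2 the equation [z^8 = 1] has only the root 1. *)
Lemma prim8_two_neq0 : 2%:R != 0 :> F.
Proof. by apply: (prim_root_dvd_eq0 hz). Qed.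

Lemma involution_free n (s : 'S_8) y q : generic y -> V8 y q ->
    s = 1%g \/ (forall i : 'I_8, s i = i + 4%:R) ->
    proj_act (t ^+ (4 * n) * p s)%g q = q -> (t ^+ (4 * n) * p s)%g = 1%g.
Proof.
elim/proj_ptW: q => x x0; rewrite /generic.
set a := y 0 0 * _; set b := _ + _; set c := _ ^+ 2 => gy /V8P /=.
rewrite -/a -/b -/c => -[q0 q1 q2 q3] hs.
rewrite proj_act_tau_perm => /esym/proj_ptP[k k0 /colP fix_x].
(* [d] is the sign [z ^+ (4 * n)], kept opaque. A fixed point becomes an eigenvector, of eigenvalue
   [k]. *)
have [d dE] : exists d : F, d = (-1) ^+ n by eexists.
have {}fix_x (i : 'I_8) : d ^+ i * x (s i) 0 = k * x i 0.
  have := fix_x i; rewrite !mxE => <-; congr (_ * _).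
  by rewrite -mulnA exprM prim8_expr4 exprM -dE -exprVn dE -exprVn invrN1.
have d2 : d ^+ 2 = 1 by rewrite dE exprAC sqrrN expr1n expr1n.
have n2 := prim8_two_neq0.
clearbody a b c => {k0}.
move: gy; rewrite /discriminant !mulf_eq0 !negb_or.
do 7![case/andP]; move=> na nb nc nD n1 n1' n4 n4'.
have nx : ~ ([/\ x (inZp 0) 0 = 0, x (inZp 2) 0 = 0, x (inZp 4) 0 = 0 & x (inZp 6) 0 = 0]
    /\ [/\ x (inZp 1) 0 = 0, x (inZp 5) 0 = 0, x (inZp 3) 0 = 0 & x (inZp 7) 0 = 0]).
  move=> [[x00 x20 x40 x60] [x10 x50 x30 x70]]; case/eqP: x0.
  by apply/colP => i; rewrite mxE -(valZpK i); case: i => -[|[|[|[|[|[|[|[|//]]]]]]]].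
case: hs => [s_id | s4].
  have {}fix_x (i : 'I_8) : d ^+ i * x i 0 = k * x i 0 by rewrite -fix_x s_id perm1.
  (* For [d = 1] the transformation is the identity; every other case contradicts [x != 0]. *)
  move/eqP: d2; rewrite sqrf_eq1 => /orP[/eqP d1 | /eqP dN1].
    have /dvdnP[m ->] : (8 %| 4 * n)%N.
      by rewrite (prim_order_dvd hz) exprM prim8_expr4 -dE d1.
    by rewrite s_id (morph_one (@proj_permM F)) mulg1 mulnC expgnA tau_expg8 expg1n.
  (* The eigenvalue 1 kills the odd coordinates, any other one the even coordinates. *)
  exfalso; apply: nx; have [k1 | k1] := eqVneq k 1.
    have odd0 j : odd (inZp j : 'I_8) -> x (inZp j) 0 = 0.
      move=> oj; have := fix_x (inZp j); rewrite dN1 -signr_odd oj k1 expr1 mulN1r mul1r.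
      move=> /eqP; rewrite eq_sym -addr_eq0 -mulr2n -mulr_natl mulf_eq0 (negPf n2).
      by move/eqP.
    have [x1 x3 x5 x7] := And4 (odd0 1 isT) (odd0 3 isT) (odd0 5 isT) (odd0 7 isT).
    split=> //; rewrite x1 x3 x5 x7 in q0 q1 q2 q3.
    have [] // := @tau4_fixed _ a b c (x (inZp 0) 0) (x (inZp 2) 0) (x (inZp 4) 0) (x (inZp 6) 0).
    - by rewrite -[RHS]q0; ring.
    - by rewrite -[RHS]q2; ring.
    - by rewrite -[RHS]oppr0 -q1; ring.
    - by rewrite -[RHS]oppr0 -q3; ring.
  have even0 j : ~~ odd (inZp j : 'I_8) -> x (inZp j) 0 = 0.
    move=> /negPf oj; have := fix_x (inZp j); rewrite dN1 -signr_odd oj expr0.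
    move/eqP; rewrite -subr_eq0 -mulrBl mulf_eq0 subr_eq0 eq_sym (negPf k1).
    by move/eqP.
  have [x00 x2 x4 x6] := And4 (even0 0 isT) (even0 2 isT) (even0 4 isT) (even0 6 isT).
  split=> //; rewrite x00 x2 x4 x6 in q0 q1 q2 q3.
  have [] // := @tau4_fixed _ a b c (x (inZp 1) 0) (x (inZp 3) 0) (x (inZp 5) 0) (x (inZp 7) 0).
  - by rewrite -[RHS]q1; ring.
  - by rewrite -[RHS]q3; ring.
  - by rewrite -[RHS]oppr0 -q2; ring.
  - by rewrite -[RHS]oppr0 -q0; ring.
exfalso; apply: nx.
have {s4}fix_x (i : 'I_8) : d ^+ i * x (i + 4%:R) 0 = k * x i 0 by rewrite -s4.
(* Two applications return to index [i] with factor [k ^+ 2], so another value would kill every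
   coordinate. *)
have k2 : k ^+ 2 = 1.
  apply/eqP; apply: contraNT x0 => k2; apply/eqP/colP => i; rewrite mxE.
  have dd : d ^+ i * d ^+ (i + 4%:R)%R = 1.
    have d8 : d ^+ 8 = 1 by rewrite (exprM d 2 4) d2 expr1n.
    rewrite (expr_mod _ d8) -exprD (_ : (i + (i + 4))%N = (2 * (i + 2))%N).
      by rewrite exprM d2 expr1n.
    by rewrite addnA addnn mulnDr mul2n.
  have e4 : i + 4%:R + 4%:R = i by rewrite -addrA (_ : 4%:R + 4%:R = 0) ?addr0 //; exact: val_inj.
  have := congr1 ( *%R (d ^+ i)) (fix_x (i + 4%:R)).
  rewrite e4 mulrA dd mul1r mulrCA fix_x mulrA -expr2 => /eqP.
  rewrite -subr_eq0 -{1}(mul1r (x i 0)) -mulrBl mulf_eq0 subr_eq0 eq_sym (negPf k2).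
  by move/eqP.
(* Coordinates 4 to 7 follow from 0 to 3, with factor [k] at even and [k * d] at odd indices. These
   are the [e] and [e'] of [translation_fixed], with product [d]. *)
have x4 : x (inZp 4) 0 = k * x (inZp 0) 0.
  have := fix_x (inZp 0); rewrite expr0 mul1r => <-; congr (x _ 0); exact: val_inj.
have x5 : x (inZp 5) 0 = k * d * x (inZp 1) 0.
  have := congr1 ( *%R d) (fix_x (inZp 1)); rewrite expr1 mulrA -expr2 d2 mul1r => e.
  by rewrite mulrAC -mulrA [x _ _ * d]mulrC mulrCA -e; congr (x _ 0); exact: val_inj.
have x6 : x (inZp 6) 0 = k * x (inZp 2) 0.
  have := fix_x (inZp 2); rewrite d2 mul1r => <-; congr (x _ 0); exact: val_inj.
have x7 : x (inZp 7) 0 = k * d * x (inZp 3) 0.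
  have := congr1 ( *%R d) (fix_x (inZp 3)); rewrite exprS d2 mulr1 mulrA -expr2 d2 mul1r => e.
  by rewrite mulrAC -mulrA [x _ _ * d]mulrC mulrCA -e; congr (x _ 0); exact: val_inj.
rewrite x4 x5 x6 x7 in q0 q1 q2 q3 *.
have kk : k * (k * d) = d by rewrite mulrA -expr2 k2 mul1r.
have [|||||||x0_ x1_ x2_ x3_] := @translation_fixed _ a b c k (k * d)
  (x (inZp 0) 0) (x (inZp 1) 0) (x (inZp 2) 0) (x (inZp 3) 0) k2.
- by rewrite exprMn k2 d2 mulr1.
- by rewrite kk; move/eqP: d2; rewrite sqrf_eq1 => /orP[]/eqP ->; rewrite ?mul1r // mulN1r opprK.
- by rewrite kk; move/eqP: d2; rewrite sqrf_eq1 => /orP[]/eqP ->; rewrite ?mul1r // !mulN1r opprK.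
- by rewrite -[RHS]q0; ring: k2 d2.
- by rewrite -[RHS]q1; ring: k2 d2.
- by rewrite -[RHS]q2; ring: k2 d2.
- by rewrite -[RHS]q3; ring: k2 d2.
by rewrite x0_ x1_ x2_ x3_ !mulr0.
Qed.

Lemma tau_perm_free (w : 'I_8) (A : {set 'S_8}) (y : 'cV[F]_3) :
    w = 3%:R \/ w = 5%:R -> {in <<A>>%g, forall s, affine w s} ->
    #|<<A>>%g| = 8%N -> generic y ->
  acts_freely (gen ([set t] `|` p @` [set` A])) (V8 y).
Proof.
move=> hw affA A8 gy; split=> [g q | g q Gg Vq gq].
  move=> /(gen_tau_permP affA)[n [s [As ->]]] Vq.
  exact: V8_tau_perm hw (affA s As) Vq.
have [//|g1] := pselect (g = 1%g); exfalso.
have [m gm1 gm2] := power_involution (gen_tau_perm_exp64 affA A8 Gg) g1.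
have Ggm := subgroupX m (gen_subgroup _) Gg.
have [n [s [e _ hs]]] := gen_tau_perm_involution affA hw Ggm gm2.
by apply: gm1; rewrite e; apply: (involution_free gy Vq hs); rewrite -e proj_act_fixX.
Qed.

End Freeness.

Lemma rmorph_discriminant (R S : comNzRingType) (f : {rmorphism R -> S}) a b c :
  f (discriminant a b c) = discriminant (f a) (f b) (f c).
Proof. by rewrite /discriminant !(rmorph_nat, rmorphXn, rmorphM, rmorphB, rmorphD). Qed.

(** * The generic parameters form a Zariski open set *)

Section GenericOpen.
Variable F : fieldType.

Lemma meval_homog n d (f : {mpoly F[n]}) (c : F) (v : 'I_n -> F) :
  f \is d.-homog -> f.@[fun i => c * v i] = c ^+ d * f.@[v].
Proof.
move=> /dhomogP hf; rewrite !mevalE mulr_sumr; apply: eq_big_seq => m /hf <-.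
rewrite mulrCA; congr (_ * _); under eq_bigr do rewrite exprMn.
by rewrite big_split prodrXr /= mdegE.
Qed.

Lemma zariski_open_nonvanishing n d (f : {mpoly F[n.+1]}) : f \is d.-homog ->
  exists U : set (proj F n), zariski_open U /\
    forall x (x0 : x != 0), U (proj_pt x0) <-> f.@[fun i => x i 0] != 0.
Proof.
move=> hf; exists (~` zero_locus [set f]); split.
  by exists [set f]; split; [move=> _ ->; exists d | rewrite setCK].
move=> x x0; split=> [nz | /eqP nz]; last by apply: contra_not nz => /(_ f x x0 erefl erefl).
apply/eqP => fx0; apply: nz => _ w w0 -> /esym/proj_ptP[c _ ->].
rewrite (_ : (fun i => _) = (fun i => c * x i 0)); last by apply/funext => i; rewrite mxE.
by rewrite (meval_homog _ _ hf) fx0 mulr0.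
Qed.

Definition discriminant_poly : {mpoly F[3]} :=
  let a := 'X_0 * 'X_2%R in let b := 'X_0 ^+ 2 + 'X_2%R ^+ 2 in let c := 'X_1 ^+ 2 in
  discriminant a b c.

(** [a], [b] and [c] are quadratic forms in [y], and every factor is homogeneous in them. *)
Lemma discriminant_homog : exists d, discriminant_poly \is d.-homog.
Proof.
have X i : ('X_i : {mpoly F[3]}) \is 1.-homog by rewrite dhomogX; apply/eqP/mdeg1.
have natM k d (f : {mpoly F[3]}) : f \is d.-homog -> k%:R * f \is d.-homog.
  by move=> hf; rewrite mulr_natl rpredMn.
rewrite /discriminant_poly; set a := 'X_0 * _; set b := _ + _; set c := _ ^+ 2.
have ha : a \is 2.-homog by exact: dhomogM (X 0) (X 2%R).
have hb : b \is 2.-homog by exact: rpredD (dhomogMn 2 (X 0)) (dhomogMn 2 (X 2%R)).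
have hc : c \is 2.-homog by exact: dhomogMn 2 (X 1).
have hm := rpredB (natM 2 _ _ ha) hb; have hp := rpredD (natM 2 _ _ ha) hb.
have hD := rpredD (natM 4 _ _ (dhomogMn 2 ha)) (dhomogMn 2 hb).
have hE := rpredB (dhomogMn 4 hp) (natM 16 _ _ (dhomogMn 4 hc)).
have hE' := rpredD (dhomogMn 4 hm) (natM 16 _ _ (dhomogMn 4 hc)).
eexists; rewrite /discriminant; have habc := dhomogM (dhomogM (dhomogM (dhomogM ha hb) hc) hD) hm.
exact: dhomogM (dhomogM (dhomogM habc hp) hE) hE'.
Qed.

Lemma meval_discriminant (v : 'cV[F]_3) :
  discriminant_poly.@[fun i => v i 0] =
  discriminant (v 0 0 * v 2%R 0) (v 0 0 ^+ 2 + v 2%R 0 ^+ 2) (v 1 0 ^+ 2).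
Proof.
rewrite /discriminant_poly (rmorph_discriminant (meval (fun i => v i 0))) /=.
by rewrite mevalM mevalD !expr2 !mevalM !mevalXU.
Qed.

End GenericOpen.

(** * The action of Z/8 on itself by powers of 5 *)

Section PowersOfFive.
Local Open Scope group_scope.

(* As 5 * 5 = 1 mod 8, conjugating tau by s1 or by its inverse raises it to the
   power 5; so no inverse is needed to turn [mul5] into the right action that
   [sdprod_by] expects. *)
Definition mul5 (x k : 'Z_8) : 'Z_8 := ((5%:R : 'Z_8) ^+ k * x)%R.

Lemma mul5_one : mul5^~ 1 =1 id.
Proof. by move=> x; rewrite /mul5 expr0 mul1r. Qed.

(** The group law of ['Z_8] is addition modulo 8, and this reduction of the exponent is harmless as
    5 squares to 1. *)
Lemma expr5D (k l : 'Z_8) : ((5%:R : 'Z_8) ^+ (k * l)%g = 5%:R ^+ k * 5%:R ^+ l)%R.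
Proof. by apply/eqP; move: k l; apply: forall_I8_pair; vm_compute. Qed.

Lemma mul5_morph x : act_morph mul5 x.
Proof. by move=> k l; rewrite /mul5 expr5D mulrAC mulrC mulrA. Qed.

Definition mul5_action : action [set: 'Z_8]%SET 'Z_8 := TotalAction mul5_one mul5_morph.

Lemma mul5_groupAction_axiom : is_groupAction [set: 'Z_8]%SET mul5_action.
Proof.
move=> k _; rewrite inE; apply/andP; split; first by apply/fintype.subsetP => x _; rewrite inE.
by apply/morphicP => x y _ _; rewrite !actpermE; apply: mulrDr.
Qed.

Definition mul5_groupAction : groupAction [set: 'Z_8]%G [set: 'Z_8]%G :=
  GroupAction mul5_groupAction_axiom.

End PowersOfFive.

(** * [G1] as an external semidirect product *)

Section StructureG1.
Variables (F : fieldType) (z : F) (hz : 8.-primitive_root z).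
Local Notation t := (tau hz).
Local Notation p := (@proj_perm F).
Local Open Scope group_scope.

Lemma G1E : G1 hz = gen ([set t] `|` p @` [set` [set s1]%SET]).
Proof.
rewrite (_ : [set` _] = [set s1]) ?image_set1 //.
by apply/seteqP; split=> s /=; rewrite inE => /eqP.
Qed.

Lemma s1_expg_tau (k : 'Z_8) n :
  p (s1 ^+ k) * t ^+ n = t ^+ (n * (5%:R ^+ k : 'I_8)%R) * p (s1 ^+ k).
Proof.
have As := affine_cycle_s1 (mem_cycle s1 k).
rewrite (proj_perm_tau hz n (affineP _ _ As)); congr (_ ^+ (n * _) * _).
rewrite permX (eq_iter s1E); apply/eqP; move: k {As}.
by apply: forall_I8; vm_compute.
Qed.

Lemma tau_s1_expg (k : 'Z_8) n :
  t ^+ n * p (s1 ^+ k) = p (s1 ^+ k) * t ^+ ((5%:R ^+ k : 'I_8)%R * n).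
Proof.
rewrite s1_expg_tau; congr (_ * _).
rewrite mulnAC -(expg_modn (_ * n) (tau_expg8 hz)) -modnMml.
have -> : ((5%:R ^+ k : 'I_8)%R * (5%:R ^+ k : 'I_8)%R %% 8 = 1)%N.
  by apply/eqP; move: k; apply: forall_I8; vm_compute.
by rewrite mul1n (expg_modn _ (tau_expg8 hz)).
Qed.

Lemma G1_sdprod_by : iso_fin (sdprod_by mul5_groupAction) (G1 hz).
Proof.
have t8 := tau_expg8 hz.
(* [sdprod_by] stores the acting component first, so the permutation stands on the left. *)
pose f (u : sdprod_by mul5_groupAction) := p (s1 ^+ u.1) * t ^+ u.2.
have f_surj n (k : 'Z_8) : exists u, f u = t ^+ n * p (s1 ^+ k).
  have hu : (k, inZp ((5%:R ^+ k : 'I_8)%R * n) : 'Z_8)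
      \in finset.setX [set: 'Z_8]%SET [set: 'Z_8]%SET by rewrite !inE.
  exists (SdPair mul5_groupAction hu).
  by rewrite tau_s1_expg /f /= (expg_modn _ t8).
exists f; split.
- move=> [[k x] /= hk] [[l y] /= hl]; rewrite /f /=.
  rewrite !(expg_modn _ t8) (expg_mod _ s1_expg8) !expgnDr (expg_modn _ t8) proj_permM.
  by rewrite -!mulgA; congr (_ * _); rewrite !mulgA tau_s1_expg.
- move=> [[k x] hk] [[l y] hl] e; apply: val_inj; move: e; rewrite /f /=.
  (* [7 * n] replaces [- n] as a natural exponent, so that equal images yield a power of [tau] equal
     to a permutation. *)
  have tX n : (t ^+ n)^-1 = t ^+ (7 * n).
    by apply/(mulgI (t ^+ n)); rewrite mulgV -expgnDr -mulSn expgnA t8 expg1n.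
  move=> e; have : t ^+ (x + 7 * y) = p ((s1 ^+ k)^-1 * s1 ^+ l).
    rewrite expgnDr -tX proj_permM (morph_inv (@proj_permM F)).
    by apply: (mulgI (p (s1 ^+ k))); rewrite !mulgA e mulgK mulgV mul1g.
  case/tau_perm_indep => /(congr1 (mul (s1 ^+ k))); rewrite mulgA mulgV mul1g mulg1.
  move=> /s1_expg_inj -> d8; congr (_, _); apply/eqP; apply: implyP d8; move: x y {hk hl e}.
  by apply: forall_I8_pair; vm_compute.
rewrite G1E; apply/seteqP; split=> [_ [u _ <-] | g].
  have [_ GM _] := gen_subgroup ([set t] `|` p @` [set` [set s1]%SET]).
  apply: GM; last by apply: subgroupX (gen_subgroup _) _; apply: sub_gen; left.
  rewrite (morph_exp (@proj_permM F)); apply: subgroupX (gen_subgroup _) _.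
  by apply: sub_gen; right; exists s1; rewrite //= inE.
case/(gen_tau_permP affine_cycle_s1) => n [s [/mem_cycle_s1P[k ->] ->]].
by have [u <-] := f_surj n k; exists u.
Qed.
End StructureG1.

(** * The factors of [G2], and noncommutation *)

Section StructureG2.
Variables (F : fieldType) (z : F) (hz : 8.-primitive_root z).
Local Notation t := (tau hz).
Local Notation p := (@proj_perm F).
Local Open Scope group_scope.

Lemma tau_expg_inj : injective (fun k : 'Z_8 => t ^+ k).
Proof.
move=> k l /= e; have [|_ d8] := @tau_perm_indep F z hz 1 (k + (8 - l)).
  rewrite (morph_one (@proj_permM F)) expgnDr e -expgnDr subnKC ?tau_expg8 //.
  exact: ltnW (ltn_ord l).
apply/eqP; apply: implyP d8; move: k l {e}.
by apply: forall_I8_pair; vm_compute.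
Qed.

Lemma gen_tau_Z8 : iso_fin 'Z_8 (gen [set t]).
Proof.
exists (fun k : 'Z_8 => t ^+ k); split; last by rewrite gen_cycle8 ?tau_expg8.
  exact: expg_Zp8M (tau_expg8 hz).
exact: tau_expg_inj.
Qed.

(** By [proj_perm_tau], commutation would give [t = t ^+ u], whereas the powers of [t] with
    exponents below 8 are distinct. *)
Lemma tau_perm_neq_comm (s : 'S_8) (u v : 'I_8) :
  (forall i : 'I_8, s i = (u * i + v)%R) -> u != 1%R -> t * p s <> p s * t.
Proof.
move=> su /eqP u1 e; apply/u1/esym/tau_expg_inj; rewrite expg1.
by apply: (mulIg (p s)); rewrite e -(mul1n u) -(proj_perm_tau hz 1 su) expg1.
Qed.

Lemma sigma23E : [set sigma2 F; sigma3 F] = p @` [set` [set s2; s3]%SET].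
Proof.
apply/seteqP; split=> [_ [|] -> | _ [s /= + <-]].
- by exists s2; rewrite //= !inE eqxx.
- by exists s3; rewrite //= !inE eqxx orbT.
- by rewrite !inE => /orP[] /eqP ->; [left | right].
Qed.

Lemma G2E : G2 hz = gen ([set t] `|` p @` [set` [set s2; s3]%SET]).
Proof.
rewrite -sigma23E; congr gen; apply/seteqP; split=> g /=.
  by case; [left | right; left | right; right].
by case=> [|[]] ->; [apply: Or31 | apply: Or32 | apply: Or33].
Qed.

End StructureG2.

Lemma gen_sigma23_Q8 (F : fieldType) (z : F) (hz : 8.-primitive_root z) :
  iso_fin 'Q_8 (gen [set sigma2 F; sigma3 F]).
Proof.
have := s2_s3_quaternion; rewrite isog_sym => /isogP[f injf im_f].
exists (@proj_perm F \o f); split.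
- by move=> x y /=; rewrite morphM ?inE // proj_permM.
- by move=> x y /= /(proj_perm_inj hz) /(injmP injf) -> //; rewrite inE.
rewrite sigma23E (gen_image (@proj_permM F)); apply/seteqP; split=> [_ [x _ <-] | _ [s /= + <-]].
  by exists (f x); rewrite //= -im_f mem_morphim ?inE.
by rewrite -im_f => /morphimP[x _ _ ->]; exists x.
Qed.

Lemma order_s1 : #[s1]%g = 8%N.
Proof.
rewrite -[RHS](card_ord 8) -cardsT -(card_imset _ s1_expg_inj); apply: eq_card => s.
apply/idP/imsetP => [/mem_cycle_s1P[k ->] | [k _ ->]]; last exact: mem_cycle.
by exists k; rewrite ?inE.
Qed.

(** The point [(1 : 1 : 2)] gives [a = 2], [b = 5], [c = 1]. *)
Lemma discriminant_neq0 (F : numFieldType) :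
  discriminant (1 * 2%:R : F) (1 ^+ 2 + 2%:R ^+ 2) (1 ^+ 2) != 0.
Proof.
have n0 k : k.+1%:R != 0 :> F by rewrite pnatr_eq0.
rewrite /discriminant !mulf_eq0 !negb_or; do !(apply/andP; split).
- exact: oner_neq0.
- exact: n0.
- by rewrite (_ : _ + _ = 5%:R) ?n0 //; ring.
- exact: oner_neq0.
- exact: oner_neq0.
- by rewrite (_ : _ + _ = 41%:R) ?n0 //; ring.
- by rewrite (_ : _ - _ = - 1%:R) ?oppr_eq0 ?n0 //; ring.
- by rewrite (_ : _ + _ = 9%:R) ?n0 //; ring.
(* [9^4 - 16 = (9^2 - 4) (9^2 + 4)]. *)
- by rewrite (_ : _ - _ = 77%:R * 85%:R) ?mulf_neq0 ?n0 //; ring.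
- by rewrite (_ : _ + _ = 17%:R) ?n0 //; ring.
Qed.

Theorem proposition2p2 (R : realType) (z : R[i]) (hz : 8.-primitive_root z) :
  [/\ nonabelian (G1 hz)
    & exists to : groupAction [set: 'Z_8]%G [set: 'Z_8]%G,
        iso_fin (sdprod_by to) (G1 hz)] /\
  [/\ nonabelian (G2 hz),
      iso_fin 'Z_8 (gen [set tau hz]),
      iso_fin 'Q_8 (gen [set sigma2 R[i]; sigma3 R[i]])
    & is_sdprod (G2 hz) (gen [set tau hz]) (gen [set sigma2 R[i]; sigma3 R[i]])] /\
  (exists U : set (proj R[i] 2),
     [/\ zariski_open U, U !=set0
       & forall (y : 'cV[R[i]]_3) (y0 : y != 0), U (proj_pt y0) ->
           acts_freely (G1 hz) (V8 y) /\ acts_freely (G2 hz) (V8 y)]).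
Proof.
split; [split | split; [split |]].
- exists (tau hz), (sigma1 _); split; try by apply: sub_gen; [left + right].
  by apply: (tau_perm_neq_comm _ (u := 5%:R) (v := 7%:R)) => // i; rewrite s1E.
- by exists mul5_groupAction; apply: G1_sdprod_by.
(* [sigma2] would not do: [s2] is a translation, so it commutes with [tau] in PGL. *)
- exists (tau hz), (sigma3 _); split; try by apply: sub_gen; constructor.
  by apply: (tau_perm_neq_comm _ (u := 3%:R) (v := 1)) => // i; rewrite s3E.
- exact: gen_tau_Z8.
- exact: (gen_sigma23_Q8 hz).
- by rewrite G2E sigma23E; apply: gen_tau_perm affine_gen_s2_s3.
have [d hd] := discriminant_homog R[i].
have [U [openU UP]] := zariski_open_nonvanishing hd.
exists U; split=> // [|y y0 /UP].
  pose y : 'cV[R[i]]_3 := \col_i (if i == 2%R then 2%:R else 1).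
  have y0 : y != 0.
    by apply/eqP => /colP /(_ 0); rewrite !mxE => /eqP; rewrite oner_eq0.
  exists (proj_pt y0); apply/UP; rewrite meval_discriminant !mxE /=.
  exact: discriminant_neq0.
rewrite meval_discriminant => gy; rewrite G1E G2E; split.
  apply: (@tau_perm_free _ _ _ 5%:R) => //; first by right.
    exact: affine_cycle_s1.
  exact: order_s1.
apply: (@tau_perm_free _ _ _ 3%:R) => //; first by left.
  exact: affine_gen_s2_s3.
by rewrite (card_isog s2_s3_quaternion) (@card_quaternion 3).
Qed.
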